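(* Let $(\mathcal{A},\varphi)$ be an algebraic probability space, $r\ge1$, and let $X=(X_1,\dots,X_r)$ and $Y=(Y_1,\dots,Y_r)$ be $r$-tuples of elements of $\mathcal{A}$ such that $\{X_i\}_{i=1}^r$ and $\{Y_j\}_{j=1}^r$ are monotone independent (in this order). Then, in $\mathbb{C}[[z_1,\dots,z_r]]$ (formal power series in non-commuting variables), $$M_{X+Y}(z_1,\dots,z_r)=M_Y(z_1,\dots,z_r)\,M_X\big(z_1M_Y(z_1,\dots,z_r),\dots,z_rM_Y(z_1,\dots,z_r)\big).$$
   Context: An algebraic probability space $(\mathcal{A},\varphi)$ is a unital $*$-algebra $\mathcal{A}$ over $\mathbb{C}$ with a state $\varphi$. **Monotone independence.** Let $\Lambda$ be linearly ordered by $<$. Subalgebras $\{\mathcal{A}_\lambda\}_{\lambda\in\Lambda}$ are monotone independent if for all $n\ge2$, $X_i\in\mathcal{A}_{\lambda_i}$ with $\lambda_i\neq\lambda_{i+1}$ ($1\le i\le n-1$), one has $\varphi(X_1\cdots X_i\cdots X_n)=\varphi(X_i)\varphi(X_1\cdots X_{i-1}X_{i+1}\cdots X_n)$ whenever $\lambda_{i-1}<\lambda_i$ and $\lambda_i>\lambda_{i+1}$ (one of the inequalities is dropped when $i=1$ or $i=n$). Subsets $S_\lambda\subset\mathcal{A}$ are monotone independent if the algebras they generate, without the unit of $\mathcal{A}$, are. When two families are said to be monotone independent, the first one listed has the smaller index. **Generating functions.** $\mathbb{C}[[z_1,\dots,z_r]]$ denotes the ring of formal power series in non-commutative generators $z_1,\dots,z_r$.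 For $X=(X_1,\dots,X_r)$, $$M_X(z_1,\dots,z_r):=1+\sum_{n=1}^\infty\sum_{i_1,\dots,i_n=1}^r\varphi(X_{i_1}\cdots X_{i_n})\,z_{i_1}\cdots z_{i_n}.$$ $X+Y=(X_1+Y_1,\dots,X_r+Y_r)$. For series $w_1,\dots,w_r$ with zero constant term, $M_X(w_1,\dots,w_r)$ denotes the series obtained by substituting $w_i$ for $z_i$, preserving the order of factors. *)

(* Defs.v *)
From HB Require Import structures.
From mathcomp Require Import all_boot all_order all_algebra.
From mathcomp Require Import classical_sets boolp functions reals.
From mathcomp Require Export complex.

Set Implicit Arguments.
Unset Strict Implicit.
Unset Printing Implicit Defensive.

Import Order.TTheory GRing.Theory Num.Theory.

Local Open Scope classical_set_scope.
Local Open Scope ring_scope.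

HB.mixin Record Algebra_isStar (C : numClosedFieldType) A of GRing.Algebra C A := {
  star : A -> A;
  starK : involutive star;
  starD : {morph star : a b / a + b};
  starZ : forall (c : C) a, star (c *: a) = c^* *: star a;
  starM : forall a b, star (a * b) = star b * star a
}.

#[short(type="starAlgType")]
HB.structure Definition StarAlgebra (C : numClosedFieldType) :=
  {A of GRing.Algebra C A & Algebra_isStar C A}.

Definition is_state (C : numClosedFieldType) (A : starAlgType C)
    (phi : {scalar A}) : Prop :=
  phi 1 = 1 /\ forall a : A, 0 <= phi (star a * a).

(* Subalgebras need not contain the unit of [A]. *)
Definition is_subalgebra (C : pzRingType) (A : algType C) (B : set A) : Prop :=
  [/\ B 0,
      forall a b, B a -> B b -> B (a + b),
      forall (c : C) a, B a -> B (c *: a)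
    & forall a b, B a -> B b -> B (a * b)].

Definition generated_algebra (C : pzRingType) (A : algType C) (S : set A) :
    set A :=
  smallest (@is_subalgebra C A) S.

(* The products over ['I_n] are taken in increasing order of the index, and    *)
(* the factor at [i] is removed on the right-hand side. At the two ends of the *)
(* word, the inequality with the missing neighbour holds vacuously.            *)
Definition monotone_independent_algebras (C : pzRingType) (A : algType C)
    (phi : A -> C) d (L : orderType d) (B : L -> set A) : Prop :=
  forall (n : nat) (l : 'I_n -> L) (X : 'I_n -> A),
    (2 <= n)%N ->
    (forall i, B (l i) (X i)) ->
    (forall i j : 'I_n, j = i.+1 :> nat -> l i != l j) ->
    forall i : 'I_n,
      (forall j : 'I_n, i = j.+1 :> nat -> (l j < l i)%O) ->
      (forall j : 'I_n, j = i.+1 :> nat -> (l j < l i)%O) ->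
      phi (\prod_(j < n) X j) = phi (X i) * phi (\prod_(j < n | j != i) X j).

Definition monotone_independent (C : pzRingType) (A : algType C)
    (phi : A -> C) d (L : orderType d) (S : L -> set A) : Prop :=
  monotone_independent_algebras phi (fun l => generated_algebra (S l)).

(* A pair of sets, indexed by [bool] with its order [false < true]: the first  *)
(* set listed has the smaller index.                                           *)
Definition monotone_independent2 (C : pzRingType) (A : algType C)
    (phi : A -> C) (S T : set A) : Prop :=
  monotone_independent phi (fun b : bool => if b then T else S).

(* Formal power series in [r] non-commuting variables, as functions from words *)
(* to coefficients, with the Cauchy product for concatenation of words.        *)
Definition ncseries (K : Type) (r : nat) : Type := seq 'I_r -> K.

Section NCSeries.
Variables (K : pzRingType) (r : nat).

HB.instance Definition _ :=
  GRing.Zmodule.copy (ncseries K r) (seq 'I_r -> K).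

Implicit Types f g h : ncseries K r.

Definition ncone : ncseries K r := fun u => (nilp u)%:R.

Definition ncmul f g : ncseries K r :=
  fun u => \sum_(k < (size u).+1) f (take k u) * g (drop k u).

Lemma ncaddE f g (u : seq 'I_r) : (f + g) u = f u + g u.
Proof. by []. Qed.

Lemma ncmulA : associative ncmul.
Proof.
have triangle N (F : nat -> nat -> K) :
    \sum_(k < N) \sum_(j < N - k) F k j
    = \sum_(m < N) \sum_(k < m.+1) F k (m - k)%N.
  transitivity (\sum_(0 <= k < N) \sum_(0 <= m < N | (k <= m)%N) F k (m - k)%N).
    rewrite big_mkord; apply: eq_bigr => -[k /= kN] _.
    rewrite -(big_nat_widenl k 0 N xpredT (fun m => F k (m - k)%N)) //.
    rewrite -[X in \sum_(X <= _ < _) _]add0n big_addn big_mkord.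
    by apply: eq_bigr => j _; rewrite addnK.
  rewrite (exchange_big_dep_nat xpredT) //= big_mkord.
  apply: eq_bigr => -[m /= mN] _.
  rewrite -(big_mkord xpredT (fun k => F k (m - k)%N)).
  by rewrite (@big_nat_widen _ _ _ 0 m.+1 N).
move=> f g h; apply/funext => u; rewrite /ncmul.
pose F k j := f (take k u) * (g (take j (drop k u)) * h (drop (j + k) u)).
transitivity (\sum_(k < (size u).+1) \sum_(j < (size u).+1 - k) F k j).
  apply: eq_bigr => -[k /= kn] _; rewrite mulr_sumr size_drop subSn //.
  by apply: eq_bigr => j _; rewrite /F drop_drop.
rewrite triangle; apply: eq_bigr => -[m /= mn] _.
rewrite mulr_suml size_take_min (minn_idPl _) //.
apply: eq_bigr => -[k /= km] _; rewrite /F subnK // mulrA.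
by rewrite take_takel // take_drop subnK.
Qed.

Lemma ncmul1s : left_id ncone ncmul.
Proof.
move=> f; apply/funext => u; rewrite /ncmul big_ord_recl take0 drop0 mul1r.
rewrite big1 ?addr0 // => -[k /= kn] _.
by rewrite /ncone /nilp size_take_min (minn_idPl _) // mul0r.
Qed.

Lemma ncmuls1 : right_id ncone ncmul.
Proof.
move=> f; apply/funext => u; rewrite /ncmul big_ord_recr /= take_size drop_size.
rewrite mulr1 big1 ?add0r // => -[k /= kn] _.
by rewrite /ncone /nilp size_drop subn_eq0 leqNgt kn mulr0.
Qed.

Lemma ncmulDl : left_distributive ncmul +%R.
Proof.
move=> f g h; apply/funext => u; rewrite [RHS]ncaddE /ncmul.
by rewrite -big_split; apply: eq_bigr => k _; exact: mulrDl.
Qed.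

Lemma ncmulDr : right_distributive ncmul +%R.
Proof.
move=> f g h; apply/funext => u; rewrite [RHS]ncaddE /ncmul.
by rewrite -big_split; apply: eq_bigr => k _; exact: mulrDr.
Qed.

HB.instance Definition _ := GRing.Zmodule_isPzRing.Build (ncseries K r)
  ncmulA ncmul1s ncmuls1 ncmulDl ncmulDr.

Lemma ncmulE f g (u : seq 'I_r) :
  (f * g) u = \sum_(k < (size u).+1) f (take k u) * g (drop k u).
Proof. by []. Qed.

Definition ncvar (i : 'I_r) : ncseries K r := fun u => (u == [:: i])%:R.

(* [ncsubst f w] is the series \sum_v f v *: (w_(v_1) * ... * w_(v_m)). When   *)
(* the [w i] have zero constant term, the words [v] longer than [u] do not     *)
(* contribute to the coefficient of [u] (lemma [ncprod_low]). The value is     *)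
(* meaningless for other [w].                                                  *)
Definition ncsubst f (w : 'I_r -> ncseries K r) : ncseries K r :=
  fun u => \sum_(m < (size u).+1) \sum_(v : m.-tuple 'I_r)
             f v * (\prod_(i <- v) w i : ncseries K r) u.

Lemma ncprod_low (w : 'I_r -> ncseries K r) (v u : seq 'I_r) :
  (forall i, w i [::] = 0) -> (size u < size v)%N ->
  (\prod_(i <- v) w i : ncseries K r) u = 0.
Proof.
move=> w0; elim: v u => [//|i v IHv] u /=; rewrite ltnS big_cons => uv.
rewrite ncmulE big1 // => -[[|k] /= ku] _; first by rewrite take0 w0 mul0r.
rewrite IHv ?mulr0 // size_drop; apply: leq_trans uv.
by rewrite subnS prednK ?leq_subr ?subn_gt0.
Qed.

End NCSeries.

Definition moment_series (C : pzRingType) (A : algType C) (phi : A -> C)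
    (r : nat) (X : 'I_r -> A) : ncseries C r :=
  fun u => if nilp u then 1 else phi (\prod_(i <- u) X i).

(* Main.v *)
Require Import Defs.
From mathcomp Require Import all_boot all_order all_algebra.
From mathcomp Require Import classical_sets functions reals.
From mathcomp Require Import boolp.

(** Expand the word [X_u1 + Y_u1] ... [X_un + Y_un] at the first factor where
    [X] is chosen: the [Y]-block in front of it is a peak, so monotone
    independence pulls out its moment, and the [X]-factor is merged with the
    previously chosen ones. This yields a recursion on [u] for the numbers
    [phi (X_x1 ... X_xk * \prod_(i <- u) (X_i + Y_i))]. The substituted series
    satisfies the same recursion, because
    [f(z M) = f [::] + \sum_j z_j M f_j(z M)] where [f_j v = f (j :: v)]. *)

Set Implicit Arguments.
Unset Strict Implicit.
Unset Printing Implicit Defensive.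

Import GRing.Theory.

Local Open Scope classical_set_scope.
Local Open Scope ring_scope.

(** * Coefficients of a substituted series *)

Section Substitution.
Variables (K : comPzRingType) (r : nat).
Implicit Types (f g : ncseries K r) (u v : seq 'I_r).

Lemma ncvar_mul_nil i g : (ncvar K i * g) [::] = 0.
Proof. by rewrite ncmulE big_ord_recl big_ord0 /ncvar mul0r addr0. Qed.

Lemma ncvar_mul_cons i g j v : (ncvar K i * g) (j :: v) = (i == j)%:R * g v.
Proof.
rewrite ncmulE big_ord_recl {1}/ncvar mul0r add0r big_ord_recl /= take0 drop0.
rewrite /ncvar eqseq_cons eqxx andbT eq_sym big1 ?addr0 // => k _.
by case: v k => [|j' v] [k kv] //=; rewrite eqseq_cons andbF mul0r.
Qed.

(** The added words are longer than [u], so [ncprod_low] kills them. This gives one common range of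
    lengths for all suffixes of a word in [ncsubst_cons]. *)
Lemma ncsubst_widen f (w : 'I_r -> ncseries K r) N u :
  (forall i, w i [::] = 0) -> (size u < N)%N ->
  ncsubst f w u = \sum_(m < N) \sum_(v : m.-tuple 'I_r)
                    f v * (\prod_(i <- v) w i : ncseries K r) u.
Proof.
move=> w0 uN; rewrite /ncsubst.
pose F m := \sum_(v : m.-tuple 'I_r)
              f v * (\prod_(i <- v) w i : ncseries K r) u.
rewrite -(big_mkord xpredT F) -[RHS](big_mkord xpredT F).
rewrite [RHS](big_cat_nat (n := (size u).+1)) //= [X in _ + X]big_nat.
rewrite [X in _ + X]big1 ?addr0 //.
move=> m /andP[um _]; rewrite /F big1 // => v _.
by rewrite ncprod_low ?mulr0 // size_tuple.
Qed.

Lemma sum_tuple_cons m (F : seq 'I_r -> K) :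
  \sum_(v : m.+1.-tuple 'I_r) F v
  = \sum_(i : 'I_r) \sum_(v : m.-tuple 'I_r) F (i :: v).
Proof.
rewrite pair_big /=.
rewrite (reindex (fun p : 'I_r * m.-tuple 'I_r => [tuple of p.1 :: p.2])) //=.
exists (fun v : m.+1.-tuple 'I_r => (thead v, [tuple of behead v])).
  by move=> [i v] _; rewrite theadE; congr pair; apply: val_inj.
by move=> v _; rewrite [RHS]tuple_eta; apply: val_inj.
Qed.

Variable g : ncseries K r.
Let w (i : 'I_r) : ncseries K r := ncvar K i * g.

Lemma ncsubst_nil f : ncsubst f w [::] = f [::].
Proof.
rewrite /ncsubst big_ord_recl big_ord0 addr0.
rewrite (bigD1 [tuple]) //= [X in _ + X]big1 => [|v]; last by rewrite (tuple0 v).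
by rewrite big_nil addr0 [X in _ * X](_ : _ = 1) ?mulr1.
Qed.

(** A product of factors [z_i g] has a nonzero coefficient at [j :: v] only if its first factor is
    [z_j g]; stripping [z_j] leaves [g] times the remaining product. *)
Lemma ncsubst_cons f j v :
  ncsubst f w (j :: v) = (g * ncsubst (fun t => f (j :: t)) w) v.
Proof.
have w0 i : w i [::] = 0 by exact: ncvar_mul_nil.
rewrite [LHS]/ncsubst big_ord_recl big1 ?add0r => [|t _]; last first.
  by rewrite (tuple0 t) big_nil [X in _ * X](_ : _ = 0) ?mulr0.
rewrite ncmulE; under [RHS]eq_bigr => k _.
  (* On the left the empty tuple is gone, so the lengths [m.+1] with [m < (size v).+1] remain; the
     same range of [m] is imposed on every suffix of [v]. *)
  rewrite (ncsubst_widen _ (N := (size v).+1)) //; last first.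
    by rewrite size_drop ltnS leq_subr.
  rewrite mulr_sumr; over.
rewrite exchange_big /=; apply: eq_bigr => m _.
rewrite (sum_tuple_cons m (fun t => f t *
  (\prod_(i <- t) w i : ncseries K r) (j :: v))).
rewrite (bigD1 j) //= [X in _ + X]big1 ?addr0 => [|i ij]; last first.
  rewrite big1 // => t _.
  by rewrite big_cons -mulrA ncvar_mul_cons (negPf ij) mul0r mulr0.
under [RHS]eq_bigr => k _ do rewrite mulr_sumr.
rewrite exchange_big /=; apply: eq_bigr => t _.
rewrite big_cons -mulrA ncvar_mul_cons eqxx mul1r ncmulE mulr_sumr.
by apply: eq_bigr => k _; rewrite mulrCA.
Qed.

(** The index [k] is the length of the prefix taken by [g]; the letter after it is absorbed by
    [ncsubst_cons]. The default [i0] is never read, as [k < size u]. *)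
Lemma mul_ncsubst f u (i0 : 'I_r) :
  (g * ncsubst f w) u
  = \sum_(k < size u) g (take k u)
      * (g * ncsubst (fun t => f (nth i0 u k :: t)) w) (drop k.+1 u)
    + g u * f [::].
Proof.
rewrite ncmulE big_ord_recr /= take_size drop_size ncsubst_nil; congr (_ + _).
by apply: eq_bigr => k _; rewrite (drop_nth i0) // ncsubst_cons.
Qed.

End Substitution.

(** * Peaks in alternating words *)

Section MonotoneIndependence.
Variables (C : comPzRingType) (A : algType C).

Lemma generated_algebra_sub (S : set A) a : S a -> generated_algebra S a.
Proof. by move=> Sa B [_ SB]; exact: SB. Qed.

Lemma generated_algebraM (S : set A) a b :
  generated_algebra S a -> generated_algebra S b -> generated_algebra S (a * b).
Proof.
by move=> Sa Sb B BS; case: (BS) => -[_ _ _ BM] _; apply: BM; [exact: Sa|exact: Sb].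
Qed.

Variables (phi : {scalar A}) (phi1 : phi 1 = 1).

Let alternating (p q : bool * A) := p.1 != q.1.

(** Independence restated for lists: an entry of the larger colour [true] in an alternating word has
    only [false] neighbours, hence is a peak. *)
Lemma monotone_peak (S T : set A) (s1 s2 : seq (bool * A)) y :
  monotone_independent2 phi S T ->
  (forall p, p \in s1 ++ (true, y) :: s2 ->
     generated_algebra (if p.1 then T else S) p.2) ->
  sorted alternating (s1 ++ (true, y) :: s2) ->
  phi (\prod_(p <- s1 ++ (true, y) :: s2) p.2)
  = phi y * phi (\prod_(p <- s1 ++ s2) p.2).
Proof.
set s := s1 ++ _; move=> indep sP sS.
pose d : bool * A := (true, 0).
(* Independence speaks of words of length at least 2; for the word [y] alone the claim is
   [phi 1 = 1]. *)
have [s_small|s_big] := leqP (size s) 1.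
  move: s_small; rewrite /s; case: s1 {s sP sS} => [|p s1] /=.
    by case: s2 => // _; rewrite big_nil big_seq1 phi1 mulr1.
  by rewrite size_cat /= addnS.
have alt := elimT (sortedP d) sS.
have is1 : (size s1 < size s)%N by rewrite /s size_cat /= addnS ltnS leq_addr.
have nth_s1 : nth d s (size s1) = (true, y) by rewrite /s nth_cat ltnn subnn.
(* Replacing the peak by 1 instead of deleting it keeps the positions aligned with those of [s]. *)
pose s' := s1 ++ (true, 1) :: s2.
have sz' : size s' = size s by rewrite /s /s' !size_cat.
have -> : \prod_(p <- s1 ++ s2) p.2 = \prod_(p <- s') p.2.
  by rewrite /s' !big_cat big_cons /= mul1r.
rewrite (big_nth d) big_mkord (big_nth d) big_mkord sz'.
have := indep (size s) (fun i => (nth d s i).1) (fun i => (nth d s i).2)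
  s_big _ _ (Ordinal is1).
rewrite /= nth_s1 => ->.
- congr (_ * phi _); rewrite big_mkcond; apply: eq_bigr => j _.
  rewrite -val_eqE /= /s /s' !nth_cat.
  case: ltngtP => // [j1|->]; last by rewrite subnn.
  by rewrite -(ltn_predK (_ : 0 < j - size s1)%N) // subn_gt0.
- by move=> i; apply: sP; exact: mem_nth.
- by move=> i j ij; rewrite ij; apply: alt; rewrite -ij.
- move=> j ij; have := alt j; rewrite -ij nth_s1 /alternating /= => /(_ is1).
  by case: (nth d s j).1.
- move=> j ij; have := alt (size s1); rewrite -ij nth_s1 => /(_ (ltn_ord j)).
  by rewrite /alternating /=; case: (nth d s j).1.
Qed.

(** * Words in the letters [X i] and [Y i] *)

Variables (r : nat) (X Y : 'I_r -> A).
Hypothesis indep : monotone_independent2 phi (range X) (range Y).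

Let letter (p : bool * 'I_r) := if p.1 then Y p.2 else X p.2.
Let gen (c : bool) := generated_algebra (if c then range Y else range X).

Let gen_letter p : gen p.1 (letter p).
Proof.
by case: p => -[] i; apply: generated_algebra_sub; exists i.
Qed.

(** The word is nonempty because the generated algebra need not contain 1; this is why empty blocks
    are treated separately below. *)
Let gen_word c i (v : seq 'I_r) :
  gen c (\prod_(j <- i :: v) letter (c, j)).
Proof.
elim: v i => [|j v IH] i; first by rewrite big_seq1; exact: (@gen_letter (c, i)).
by rewrite big_cons; exact: generated_algebraM (@gen_letter (c, i)) (IH j).
Qed.

(** Maximal runs of letters of one colour are multiplied together. The first block keeps the colour
    of [p], so it can be placed after a block of the other colour. *)
Lemma alternating_blocks p (s : seq (bool * 'I_r)) :
  exists a t, [/\ \prod_(q <- p :: s) letter q = a * \prod_(q <- t) q.2,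
    path alternating (p.1, a) t &
    forall q, q \in (p.1, a) :: t -> gen q.1 q.2].
Proof.
elim: s p => [|p' s IH] p.
  exists (letter p), [::]; split=> //; first by rewrite big_seq1 big_nil mulr1.
  by move=> q; rewrite inE => /eqP->; exact: gen_letter.
have [a [t [prodE tP tG]]] := IH p'.
have [pp|pp] := eqVneq p.1 p'.1.
  exists (letter p * a), t; split.
  - by rewrite big_cons prodE mulrA.
  - by rewrite pp; case: (t) tP.
  - move=> q; rewrite inE => /predU1P[-> /=|qt]; last first.
      by apply: tG; rewrite inE qt orbT.
    apply: generated_algebraM; first exact: gen_letter.
    by rewrite pp; apply: (tG (p'.1, a)); exact: mem_head.
exists (letter p), ((p'.1, a) :: t); split.
- by rewrite big_cons prodE big_cons.
- by rewrite /= tP andbT.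
- by move=> q; rewrite inE => /predU1P[->|]; [exact: gen_letter|exact: tG].
Qed.

Lemma mixed_word_peak (x b : seq 'I_r) i (s : seq (bool * 'I_r)) :
  phi (\prod_(j <- x) X j * \prod_(j <- b) Y j
       * \prod_(q <- (false, i) :: s) letter q)
  = moment_series phi Y b
    * phi (\prod_(j <- x) X j * \prod_(q <- (false, i) :: s) letter q).
Proof.
have [a [t [-> /= tP tG]]] := alternating_blocks (false, i) s.
case: b => [|j b]; first by rewrite big_nil mulr1 /moment_series /= mul1r.
have yG := @gen_word true j b.
rewrite /moment_series [nilp _]/=; set y := \prod_(_ <- _ :: _) _ in yG *.
case: x => [|k x].
  rewrite big_nil !mul1r.
  have := @monotone_peak (range X) (range Y) [::] ((false, a) :: t) y indep.
  rewrite /= !big_cons /=; apply=> // q; rewrite inE => /predU1P[->//|]; exact: tG.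
have xG := @gen_word false k x.
set z := \prod_(_ <- _ :: _) _ in xG *.
(* The block [z] is adjacent to [a] once the peak is removed: the right-hand
   side need not be alternating. *)
have := @monotone_peak (range X) (range Y) [:: (false, z)] ((false, a) :: t) y
  indep.
rewrite /= !big_cons /= !mulrA; apply=> // q.
by rewrite 2!inE => /or3P[/eqP->//|/eqP->//|]; exact: tG.
Qed.

Lemma sum_word_peak (x b : seq 'I_r) i (u : seq 'I_r) :
  phi (\prod_(j <- x) X j * \prod_(j <- b) Y j
       * (X i * \prod_(j <- u) (X j + Y j)))
  = moment_series phi Y b
    * phi (\prod_(j <- rcons x i) X j * \prod_(j <- u) (X j + Y j)).
Proof.
rewrite big_rcons /= -[in RHS]mulrA.
(* The sums are expanded one letter at a time, [s] recording the choices made. Every resulting word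
   still has [X i] right after the [Y]-block, which therefore stays a peak. *)
suff mixed s : phi (\prod_(j <- x) X j * \prod_(j <- b) Y j
      * (\prod_(q <- (false, i) :: s) letter q * \prod_(j <- u) (X j + Y j)))
    = moment_series phi Y b
      * phi (\prod_(j <- x) X j
        * (\prod_(q <- (false, i) :: s) letter q * \prod_(j <- u) (X j + Y j))).
  by have := mixed [::]; rewrite big_seq1.
elim: u s => [|j u IH] s.
  by rewrite big_nil !mulr1; exact: mixed_word_peak.
have step : \prod_(q <- (false, i) :: s) letter q * \prod_(k <- j :: u) (X k + Y k)
    = \sum_(c : bool) \prod_(q <- (false, i) :: rcons s (c, j)) letter q
                      * \prod_(k <- u) (X k + Y k).
  rewrite big_bool -!rcons_cons !big_rcons /= -mulrDl -mulrDr.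
  by rewrite [\prod_(_ <- j :: _) _]big_cons [Y j + _]addrC mulrA.
rewrite step !mulr_sumr !raddf_sum mulr_sumr /=.
by apply: eq_bigr => c _; exact: IH.
Qed.

(** * The recursion and its solution *)

Lemma prod_add_first (u : seq 'I_r) (i0 : 'I_r) :
  \prod_(j <- u) (X j + Y j)
  = \sum_(k < size u) \prod_(j <- take k u) Y j
      * (X (nth i0 u k) * \prod_(j <- drop k.+1 u) (X j + Y j))
    + \prod_(j <- u) Y j.
Proof.
elim: u => [|i u IH]; first by rewrite !big_nil big_ord0 add0r.
rewrite big_cons mulrDl {2}IH mulrDr mulr_sumr addrA big_ord_recl /= drop0.
rewrite big_nil mul1r [\prod_(j <- i :: u) Y j]big_cons; congr (_ + _ + _).
by apply: eq_bigr => k _; rewrite big_cons !mulrA.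
Qed.

Lemma moment_sum_recursion (x u : seq 'I_r) (i0 : 'I_r) :
  phi (\prod_(j <- x) X j * \prod_(j <- u) (X j + Y j))
  = \sum_(k < size u) moment_series phi Y (take k u)
      * phi (\prod_(j <- rcons x (nth i0 u k)) X j
             * \prod_(j <- drop k.+1 u) (X j + Y j))
    + moment_series phi Y u * phi (\prod_(j <- x) X j).
Proof.
rewrite (prod_add_first u i0) mulrDr mulr_sumr raddfD raddf_sum /=.
congr (_ + _); first by apply: eq_bigr => k _; rewrite mulrA sum_word_peak.
(* When no [X] is chosen, the [Y]-block ends the word and is a peak with no right neighbour. *)
case: u => [|j u]; first by rewrite big_nil mulr1 /moment_series /= mul1r.
have yG := @gen_word true j u.
rewrite /moment_series [nilp _]/=; set y := \prod_(_ <- _ :: _) _ in yG *.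
case: x => [|k x]; first by rewrite big_nil mul1r phi1 mulr1.
have xG := @gen_word false k x.
set z := \prod_(_ <- _ :: _) _ in xG *.
have := @monotone_peak (range X) (range Y) [:: (false, z)] [::] y indep.
rewrite /= !big_cons !big_nil /= !mulr1; apply=> // q.
by rewrite !inE => /orP[]/eqP->.
Qed.

Lemma moment_seriesE (Z : 'I_r -> A) (u : seq 'I_r) :
  moment_series phi Z u = phi (\prod_(j <- u) Z j).
Proof. by case: u => //; rewrite /moment_series /= big_nil phi1. Qed.

(** Induction on the length of [u], for all [x] at once, since the recursion moves a letter from [u]
    to the end of [x]. On the series side this move is the passage from [f] to [f_j]. *)
Lemma moment_sum_subst (x u : seq 'I_r) :
  phi (\prod_(j <- x) X j * \prod_(j <- u) (X j + Y j))
  = (moment_series phi Y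
     * ncsubst (fun t => moment_series phi X (x ++ t))
         (fun i => ncvar C i * moment_series phi Y)) u.
Proof.
have [n] := ubnP (size u); elim: n => // n IH in x u *; rewrite ltnS => un.
case: u un => [|i0 u] un.
  rewrite ncmulE big_ord_recl big_ord0 addr0 ncsubst_nil cats0.
  by rewrite !moment_seriesE !big_nil phi1 mulr1 mul1r.
rewrite (moment_sum_recursion _ _ i0) (mul_ncsubst _ _ _ i0) cats0.
congr (_ + _); last by rewrite [moment_series _ X _]moment_seriesE.
apply: eq_bigr => k _; congr (_ * _); rewrite IH.
  congr ((_ * ncsubst _ _) _); apply: funext => t.
  by rewrite cat_rcons.
by rewrite size_drop; apply: leq_trans un; rewrite /= subSS ltnS leq_subr.
Qed.

End MonotoneIndependence.

Theorem theorem6p1 (R : realType) (A : starAlgType R[i]) (phi : {scalar A})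
    (r : nat) (X Y : 'I_r -> A) :
  is_state phi ->
  (1 <= r)%N ->
  monotone_independent2 phi (range X) (range Y) ->
  let MX := moment_series phi X in
  let MY := moment_series phi Y in
  moment_series phi (fun i => X i + Y i)
  = MY * ncsubst MX (fun i => ncvar R[i] i * MY).
Proof.
move=> [phi1 _] _ indep MX MY; apply: funext => u.
have := @moment_sum_subst _ _ phi phi1 r X Y indep [::] u.
by rewrite big_nil mul1r moment_seriesE.
Qed.
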